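(* Let $A$ be an integral ring. There exists a pair $(\mathrm{div}_A,\mathrm{Div}\,A)$ consisting of a lattice-ordered abelian group $\mathrm{Div}\,A$ (written additively) and a map $\mathrm{div}_A : A^*\to(\mathrm{Div}\,A)^+$ satisfying (D1) $\mathrm{div}_A(1)=0$ and $\mathrm{div}_A(ab)=\mathrm{div}_A(a)+\mathrm{div}_A(b)$ for all $a,b\in A^*$; (D2) for all $a,b\in A^*$: $\mathrm{div}_A(a)\leq \mathrm{div}_A(b)$ if and only if $a$ divides $b$ in $A$; (D3) every element of $(\mathrm{Div}\,A)^+$ is the infimum in $\mathrm{Div}\,A$ of a finite (nonempty) family of elements of $\mathrm{div}_A(A^* )$; if and only if $A$ is a ring with divisors (i.e. every nonempty finite family in $A^*$ is divisorially invertible). In this case the pair $(\mathrm{div}_A,\mathrm{Div}\,A)$ is unique up to unique isomorphism.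
   Context: Rings are commutative with unit. A ring is integral if every element is zero or regular (the trivial ring is not excluded). $A^*$ denotes the set of regular elements of $A$. For a lattice-ordered group $G$, $G^+=\{x\in G: x\ge 0\}$. An element $g\in A^*$ is a strong gcd of a finite list $(a_1,\dots,a_n)$ in $A^*$ if for every $x\in A^*$ the element $xg$ is a gcd of $(xa_1,\dots,xa_n)$ in $A$. A finite nonempty list $(a_1,\dots,a_n)$ in $A^*$ is divisorially invertible if there is a finite list $(b_1,\dots,b_m)$ in $A^*$ such that the family $(a_ib_j)_{i,j}$ has a strong gcd in $A^*$. This depends only on the ideal $\langle a_1,\dots,a_n\rangle$. An integral ring $A$ is a ring with divisors (''anneau à diviseurs'', Prüfer $v$-multiplication domain) if every nonzero finitely generated ideal is divisorially invertible, i.e. every nonempty finite list in $A^*$ is divisorially invertible. *)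

(* Defs.v *)
From mathcomp Require Import all_boot all_order all_algebra.

Set Implicit Arguments.
Unset Strict Implicit.
Unset Printing Implicit Defensive.

Import Order.TTheory GRing.Theory.
Local Open Scope ring_scope.

Definition is_infimum (G : porderZmodType) (g : G) (s : seq G) : Prop :=
  (forall h, h \in s -> g <= h) /\
  (forall l, (forall h, h \in s -> l <= h) -> l <= g).

Definition is_supremum (G : porderZmodType) (g : G) (s : seq G) : Prop :=
  (forall h, h \in s -> h <= g) /\
  (forall u, (forall h, h \in s -> h <= u) -> g <= u).

(* Order.Lattice cannot be joined with GRing.Zmodule above Num.RealDomain, hence
   a predicate: a porderZmodType has no compatibility between + and <=. *)
Record lattice_ordered_group (G : porderZmodType) : Prop := LatticeOrderedGroup {
  translation_le : forall z x y : G, x <= y -> z + x <= z + y;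
  infimum2 : forall x y : G, exists m, is_infimum m [:: x; y];
  supremum2 : forall x y : G, exists j, is_supremum j [:: x; y]
}.

(* Being bijective and an order embedding, phi preserves and reflects infima and
   suprema. *)
Definition lgroup_isomorphism (G H : porderZmodType) (phi : G -> H) : Prop :=
  [/\ bijective phi,
      {morph phi : x y / x + y}
    & {mono phi : x y / x <= y}].

(* comPzRingType rather than comNzRingType: the trivial ring is allowed, and
   its element 0 is regular. *)
Definition integral_ring (A : comPzRingType) : Prop :=
  forall x : A, x = 0 \/ GRing.lreg x.

(* The multiplicative monoid A^* of regular elements. *)
Record regular (A : comPzRingType) := Regular {
  regular_val :> A;
  regularP : GRing.lreg regular_val
}.
Arguments Regular {A} _ _.
Arguments regularP {A} _ [_ _] _.

Definition regular_one (A : comPzRingType) : regular A :=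
  Regular 1 (@lreg1 A).

Definition regular_mul (A : comPzRingType) (a b : regular A) : regular A :=
  Regular ((a : A) * (b : A)) (lregM (regularP a) (regularP b)).

Definition divides (A : comPzRingType) (a b : A) : Prop :=
  exists c : A, b = c * a.

Definition is_gcd (A : comPzRingType) (g : A) (s : seq A) : Prop :=
  (forall a, a \in s -> divides g a) /\
  (forall d, (forall a, a \in s -> divides d a) -> divides d g).

Definition is_strong_gcd (A : comPzRingType) (g : regular A)
    (s : seq (regular A)) : Prop :=
  forall x : regular A,
    is_gcd ((x : A) * (g : A)) [seq (x : A) * (a : A) | a : regular A <- s].

Definition divisorially_invertible (A : comPzRingType)
    (s : seq (regular A)) : Prop :=
  exists (t : seq (regular A)) (g : regular A),
    is_strong_gcd g [seq regular_mul a b | a <- s, b <- t].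

Definition ring_with_divisors (A : comPzRingType) : Prop :=
  integral_ring A /\
  forall s : seq (regular A), s <> [::] -> divisorially_invertible s.

(* (div, G) is a pair (div_A, Div A); by div_ge0, div takes its values
   in the positive cone of G. *)
Record is_divisor_theory (A : comPzRingType) (G : porderZmodType)
    (div : regular A -> G) : Prop := IsDivisorTheory {
  div_lgroup : lattice_ordered_group G;
  div_ge0 : forall a, 0 <= div a;
  div_one : div (regular_one A) = 0;
  div_mul : forall a b, div (regular_mul a b) = div a + div b;
  div_le : forall a b, div a <= div b <-> divides (a : A) (b : A);
  div_inf : forall g : G, 0 <= g ->
    exists s : seq (regular A), s <> [::] /\ is_infimum g (map div s)
}.

(* Main.v *)
Require Import Defs.
From HB Require Import structures.
From mathcomp Require Import all_boot all_order all_algebra.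
From mathcomp Require Import boolp.
From mathcomp Require Import ring.

(** In a divisor theory every element has the form inf div(s) - div c with s a
    nonempty list and c an element of A^*. Indeed div a - inf div(s) >= 0 for a
    in s, hence it is inf div(t) for some list t, and this turns every
    inequality between such elements into divisibilities in A: the order of
    Div A is determined by A, which gives uniqueness. The same t shows that a is
    a strong gcd of the products of s and t. Conversely, the preorder so defined
    on the pairs (s, c) always gives a partially ordered monoid with binary
    infima, and divisorial invertibility of s is what provides an opposite of
    (s, c). *)

Set Implicit Arguments.
Unset Strict Implicit.
Unset Printing Implicit Defensive.

Import Order.TTheory GRing.Theory.
Local Open Scope ring_scope.
Local Open Scope quotient_scope.

HB.instance Definition _ (A : comPzRingType) := gen_eqMixin (regular A).
HB.instance Definition _ (A : comPzRingType) := gen_choiceMixin (regular A).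

(** * Divisibility, products of lists and strong gcds *)

Section Divisibility.
Variable A : comPzRingType.
Implicit Types (x y z : A) (a b c : regular A) (s t : seq (regular A)).

Lemma divides_eq y z x : divides x y -> y = z -> divides x z.
Proof. by move=> dvd_xy <-. Qed.

Lemma divides_mulr z x y : divides x y -> divides x (z * y).
Proof. by case=> c ->; exists (z * c); rewrite mulrA. Qed.

Lemma divides_mul2 z x y : divides x y -> divides (z * x) (z * y).
Proof. by case=> c ->; exists c; ring. Qed.

Lemma divides_mul2I c x y : divides ((c : A) * x) ((c : A) * y) -> divides x y.
Proof.
case=> d eq_cy; exists d; apply: (regularP c); rewrite eq_cy.
by ring.
Qed.

(** Lets a common divisor [y], a priori any element of the ring, be packed as an element of A^*,
    where [div] applies. *)
Lemma divides_regular a y : divides y a -> GRing.lreg y.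
Proof.
case=> c eq_a u v eq_yuv; apply: (regularP a).
by rewrite eq_a -!mulrA eq_yuv.
Qed.

Definition list_mul s t : seq (regular A) :=
  [seq regular_mul a b | a <- s, b <- t].

Lemma list_mul_neq0 s t : s <> [::] -> t <> [::] -> list_mul s t <> [::].
Proof. by case: s t => [|a s] [|b t]. Qed.

Lemma map_neq0 (T U : Type) (f : T -> U) (r : seq T) :
  r <> [::] -> map f r <> [::].
Proof. by case: r. Qed.

Lemma list_mulP s t c :
  reflect (exists a b, [/\ a \in s, b \in t & c = regular_mul a b])
          (c \in list_mul s t).
Proof.
apply: (iffP allpairsP) => [[[a b]] /= [sa tb ->]|[a [b [sa tb ->]]]].
  by exists a, b.
by exists (a, b).
Qed.

Lemma mem_list_mul s t a b :
  a \in s -> b \in t -> regular_mul a b \in list_mul s t.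
Proof. exact: allpairs_f. Qed.

(* An empty cofactor list makes 0 regular, so it only occurs in the trivial
   ring, where every list will do. *)
Lemma divisorially_invertible_neq0 s : divisorially_invertible s ->
  exists (t : seq (regular A)) (g : regular A),
    t <> [::] /\ is_strong_gcd g (list_mul s t).
Proof.
case=> [[|b t] [g gcd_g]]; last by exists (b :: t), g.
have nil_mul : [seq regular_mul a b | a <- s, b <- [::]] = [::].
  by elim: s {gcd_g}.
have A0 x : x = 0.
  have [_ dvd_1g] := gcd_g (regular_one A).
  have [|c] := dvd_1g 0; first by rewrite nil_mul.
  by rewrite mulr0 mul1r => g0; apply: (regularP g); rewrite g0 !mul0r.
by exists [:: regular_one A], g; split=> // x; split=> y *; exists 0;
  rewrite [LHS]A0 [RHS]A0.
Qed.

(** Being a common divisor only has to be tested at [x = 1], since divisibility survives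
    multiplication by [x]; only the maximality of the gcd depends on [x]. *)
Lemma strong_gcdP g s : is_strong_gcd g s <->
  (forall a, a \in s -> divides (g : A) (a : A)) /\
  (forall (x : regular A) y,
    (forall a, a \in s -> divides y ((x : A) * (a : A))) ->
    divides y ((x : A) * (g : A))).
Proof.
split=> [gcd_g|[dvd_g gcd_g] x]; split.
- move=> a sa; have [dvd_g _] := gcd_g (regular_one A).
  by have := dvd_g _ (map_f _ sa); rewrite /= !mul1r.
- move=> x y dvd_y; apply: (gcd_g x).2 => _ /mapP[a sa ->]; exact: dvd_y.
- by move=> _ /mapP[a sa ->]; apply/divides_mul2/dvd_g.
- move=> y dvd_y; apply: gcd_g => a sa; apply: dvd_y.
  exact: (map_f (fun a : regular A => (x : A) * (a : A))).
Qed.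

(** Each quotient divides a regular element, hence is regular, so the quotients form a list in
    A^*. *)
Lemma divides_all c s : (forall a, a \in s -> divides (c : A) (a : A)) ->
  exists t, map (@regular_val A) s
    = [seq (c : A) * (b : A) | b : regular A <- t].
Proof.
elim: s => [|a s IHs] dvd_s; first by exists [::].
have [|t eq_s] := IHs.
  by move=> b sb; apply: dvd_s; rewrite inE sb orbT.
have [b eq_a] := dvd_s a (mem_head _ _).
have reg_b : GRing.lreg b.
  by apply: (@divides_regular a); exists (c : A); rewrite eq_a mulrC.
by exists (Regular b reg_b :: t); rewrite /= eq_s eq_a mulrC.
Qed.

(** * Formal divisors: preorder, sum, infimum and inverse of fractions *)

(* The fraction (s, c) stands for the divisor inf div(s) - div c. *)
Record fraction := Fraction {
  num : seq (regular A);
  den : regular A;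
  num_neq0 : num <> [::]
}.
Implicit Types p q r : fraction.

(* When Div A exists, y | x c' a for all a in s means that
   div y - div x <= inf div(s) + div c'. Thus (s, c) <= (t, c') says that every
   difference div y - div x below inf div(s) + div c' is also below
   inf div(t) + div c. *)
Definition frac_le p q : Prop :=
  forall b, b \in num q -> forall (x : regular A) y,
    (forall a, a \in num p -> divides y ((x : A) * (den q : A) * (a : A))) ->
    divides y ((x : A) * (den p : A) * (b : A)).

(** The sum of two divisors: addition distributes over infima, so the numerators multiply
    pairwise. *)
Definition frac_mul p q : fraction :=
  Fraction (regular_mul (den p) (den q))
    (list_mul_neq0 (@num_neq0 p) (@num_neq0 q)).

Lemma seq1_neq0 (T : Type) (x : T) : [:: x] <> [::].
Proof. by []. Qed.

Definition frac_div a : fraction := Fraction (regular_one A) (@seq1_neq0 _ a).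

Lemma cat_neq0 (T : Type) (r1 r2 : seq T) : r1 <> [::] -> r1 ++ r2 <> [::].
Proof. by case: r1. Qed.

(** Both fractions are brought to the common denominator; concatenating the numerators then gives
    the infimum. *)
Definition frac_inf p q : fraction :=
  Fraction (regular_mul (den p) (den q))
    (cat_neq0 (r2 := map (regular_mul (den p)) (num q))
       (map_neq0 (f := regular_mul (den q)) (@num_neq0 p))).

Lemma frac_le_refl p : frac_le p p.
Proof. by move=> b pb x y; apply. Qed.

(** Both hypotheses are applied to the divisor [den q * y]: the extra factor makes room for the
    denominator of [q], and is cancelled at the end because it is regular. *)
Lemma frac_le_trans q p r : frac_le p q -> frac_le q r -> frac_le p r.
Proof.
move=> le_pq le_qr b rb x y dvd_y; apply: (@divides_mul2I (den q)).
apply: divides_eq (le_qr _ rb (regular_mul x (den p)) _ _) _; last first.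
  by rewrite /=; ring.
move=> a qa.
apply: divides_eq (le_pq _ qa (regular_mul x (den r)) _ _) _; last first.
  by rewrite /=; ring.
move=> a' pa'; apply: divides_eq (divides_mul2 (den q) (dvd_y _ pa')) _.
by rewrite /=; ring.
Qed.

(** The multiplier [x] in [frac_le] absorbs the factors coming from [r]; this is why that quantifier
    is there, as in the definition of a strong gcd. *)
Lemma frac_le_mul p q r : frac_le p q -> frac_le (frac_mul p r) (frac_mul q r).
Proof.
move=> le_pq _ /list_mulP[b [c [qb rc ->]]] x y dvd_y /=.
apply: divides_eq
  (le_pq _ qb (regular_mul (regular_mul x (den r)) c) _ _) _; last first.
  by rewrite /=; ring.
move=> a pa; apply: divides_eq (dvd_y _ (mem_list_mul pa rc)) _.
by rewrite /=; ring.
Qed.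

Lemma frac_le_mulC p q : frac_le (frac_mul p q) (frac_mul q p).
Proof.
move=> _ /list_mulP[b [c [qb pc ->]]] x y dvd_y.
by apply: divides_eq (dvd_y _ (mem_list_mul pc qb)) _; rewrite /=; ring.
Qed.

Lemma frac_le_mulA p q r :
  frac_le (frac_mul p (frac_mul q r)) (frac_mul (frac_mul p q) r).
Proof.
move=> _ /list_mulP[_ [c [/list_mulP[a [b [pa qb ->]]] rc ->]]] x y dvd_y.
apply: divides_eq (dvd_y _ (mem_list_mul pa (mem_list_mul qb rc))) _.
by rewrite /=; ring.
Qed.

Lemma frac_le_1mul p : frac_le (frac_mul (frac_div (regular_one A)) p) p.
Proof.
move=> b pb x y dvd_y.
apply: divides_eq (dvd_y _ (mem_list_mul (mem_head _ _) pb)) _.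
by rewrite /=; ring.
Qed.

Lemma frac_le_mul1 p : frac_le p (frac_mul (frac_div (regular_one A)) p).
Proof.
move=> _ /list_mulP[b [c [/[!inE] /eqP-> pc ->]]] x y dvd_y.
by apply: divides_eq (dvd_y _ pc) _; rewrite /=; ring.
Qed.

Lemma frac_le_infl p q : frac_le (frac_inf p q) p.
Proof.
move=> b pb x y dvd_y; apply: divides_eq (dvd_y (regular_mul (den q) b) _) _.
  by rewrite mem_cat map_f.
by rewrite /=; ring.
Qed.

Lemma frac_le_infr p q : frac_le (frac_inf p q) q.
Proof.
move=> b qb x y dvd_y; apply: divides_eq (dvd_y (regular_mul (den p) b) _) _.
  by rewrite mem_cat orbC map_f.
by rewrite /=; ring.
Qed.

Lemma frac_le_inf p q r : frac_le r p -> frac_le r q -> frac_le r (frac_inf p q).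
Proof.
move=> le_rp le_rq b; rewrite mem_cat => /orP[] /mapP[c pqc ->] x y dvd_y.
  apply: divides_eq (le_rp _ pqc (regular_mul x (den q)) _ _) _; last first.
    by rewrite /=; ring.
  by move=> a ra; apply: divides_eq (dvd_y _ ra) _; rewrite /=; ring.
apply: divides_eq (le_rq _ pqc (regular_mul x (den p)) _ _) _; last first.
  by rewrite /=; ring.
by move=> a ra; apply: divides_eq (dvd_y _ ra) _; rewrite /=; ring.
Qed.

Lemma frac_le_div a b :
  frac_le (frac_div a) (frac_div b) <-> divides (a : A) (b : A).
Proof.
split=> [le_ab|dvd_ab _ /[!inE]/eqP-> x y /(_ _ (mem_head _ _)) dvd_y].
  apply: divides_eq (le_ab _ (mem_head _ _) (regular_one A) _ _) _; last first.
    by rewrite /=; ring.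
  by move=> _ /[!inE]/eqP->; exists 1; rewrite /=; ring.
have [[d eq_xa] [e eq_b]] := (dvd_y, dvd_ab); exists (e * d).
by rewrite -[RHS]mulrA -eq_xa eq_b /=; ring.
Qed.

Lemma frac_le_divM a b :
  frac_le (frac_div (regular_mul a b)) (frac_mul (frac_div a) (frac_div b)).
Proof.
move=> _ /list_mulP[c [d [/[!inE]/eqP-> /eqP-> ->]]] x y dvd_y.
by apply: divides_eq (dvd_y _ (mem_head _ _)) _; rewrite /=; ring.
Qed.

Lemma frac_le_Mdiv a b :
  frac_le (frac_mul (frac_div a) (frac_div b)) (frac_div (regular_mul a b)).
Proof.
move=> _ /[!inE]/eqP-> x y dvd_y.
have := dvd_y _ (mem_list_mul (mem_head _ _) (mem_head _ _)).
by move/divides_eq; apply; rewrite /=; ring.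
Qed.

(** If [g] is a strong gcd of the products of [num p] and [t], then inf div(num p) + inf div(t) =
    div g, so the opposite is inf div(t) + div (den p) - div g. The maximality of [g] gives one
    inequality, and its being a common divisor gives the other. *)
Lemma frac_inverse p : divisorially_invertible (num p) ->
  exists q, frac_le (frac_mul p q) (frac_div (regular_one A)) /\
            frac_le (frac_div (regular_one A)) (frac_mul p q).
Proof.
move=> /divisorially_invertible_neq0[t [g [t_neq0 /strong_gcdP[dvd_g gcd_g]]]].
exists (Fraction g (map_neq0 (f := regular_mul (den p)) t_neq0)); split.
  move=> _ /[!inE]/eqP-> x y dvd_y.
  apply: divides_eq (gcd_g (regular_mul x (den p)) y _) _; last first.
    by rewrite /=; ring.
  move=> _ /list_mulP[a [b [pa tb ->]]].
  apply: divides_eq (dvd_y _ (mem_list_mul pa (map_f _ tb))) _.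
  by rewrite /=; ring.
move=> _ /list_mulP[a [_ [pa /mapP[b tb ->] ->]]] x y.
move=> /(_ (regular_one A) (mem_head _ _)) dvd_y.
have [c /= eq_ab] := dvd_g _ (mem_list_mul pa tb).
apply: divides_eq (divides_mulr c dvd_y) _.
transitivity ((x : A) * (den p : A) * ((a : A) * (b : A))).
  by rewrite eq_ab /=; ring.
by rewrite /=; ring.
Qed.

(** Nonnegativity forces the denominator to divide every numerator, and [t] is the list of
    quotients. *)
Lemma frac_ge0_inf p : frac_le (frac_div (regular_one A)) p ->
  exists t, [/\ t <> [::], (forall b, b \in t -> frac_le p (frac_div b)) &
    forall q, (forall b, b \in t -> frac_le q (frac_div b)) -> frac_le q p].
Proof.
move=> p_ge0.
have [|t eq_num] := @divides_all (den p) (num p).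
  move=> a pa.
  (* The hypothesis is tested at [x = 1] and [y = den p]. *)
  apply: divides_eq (p_ge0 _ pa (regular_one A) _ _) _; last first.
    by rewrite /=; ring.
  by move=> _ /[!inE]/eqP->; exists 1; rewrite /=; ring.
exists t; split.
- by move=> t0; case: (num p) (@num_neq0 p) eq_num; rewrite t0.
- move=> b tb _ /[!inE]/eqP-> x y dvd_y.
  have : (den p : A) * (b : A) \in map (@regular_val A) (num p).
    rewrite eq_num.
    exact: (map_f (fun b : regular A => (den p : A) * (b : A))).
  case/mapP=> a pa eq_a; rewrite -mulrA eq_a.
  by apply: divides_eq (dvd_y _ pa) _; rewrite /=; ring.
move=> q le_qt a pa x y dvd_y.
have : (a : A) \in map (@regular_val A) (num p) by apply: map_f.
rewrite eq_num => /mapP[b tb ->].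
apply: divides_eq
  (le_qt _ tb _ (mem_head _ _) (regular_mul x (den p)) _ _) _; last first.
  by rewrite /=; ring.
by move=> c qc; apply: divides_eq (dvd_y _ qc) _; rewrite /=; ring.
Qed.

End Divisibility.

Arguments frac_le_refl {A} p.
Arguments frac_le_trans {A} q {p r} _ _.
Arguments frac_le_mul {A p q} r _.
Arguments frac_le_mulC {A} p q.
Arguments frac_le_mulA {A} p q r.

HB.instance Definition _ (A : comPzRingType) := gen_eqMixin (fraction A).
HB.instance Definition _ (A : comPzRingType) := gen_choiceMixin (fraction A).

(** * The ordered group of divisors, as a quotient of the fractions *)

Section DivisorGroup.
Variables (A : comPzRingType) (rwdA : ring_with_divisors A).
Implicit Types (a b : regular A) (p q r : fraction A).

Definition frac_eqv : rel (fraction A) :=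
  fun p q => `[< frac_le p q /\ frac_le q p >].

Lemma frac_eqv_is_equiv : equiv_class_of frac_eqv.
Proof.
split=> [p|p q|q p r].
- by apply/asboolP; split; apply: frac_le_refl.
- by apply/asboolP/asboolP=> -[].
- move=> /asboolP[le_pq le_qp] /asboolP[le_qr le_rq]; apply/asboolP.
  by split; apply: (frac_le_trans q).
Qed.

Canonical frac_eqv_equiv := EquivRelPack frac_eqv_is_equiv.

(* Opposites come from rwdA, which the type therefore carries as a phantom
   argument. *)
Definition divisor (_ : ring_with_divisors A) := {eq_quot frac_eqv}.

Local Notation Div := (divisor rwdA).
HB.instance Definition _ := Choice.copy Div {eq_quot frac_eqv}.

Definition to_divisor p : Div := \pi_({eq_quot frac_eqv}) p.
Definition divisor_repr (X : Div) : fraction A :=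
  repr (X : {eq_quot frac_eqv}).

Lemma divisor_reprK : cancel divisor_repr to_divisor.
Proof. exact: reprK. Qed.

Lemma eq_to_divisor p q :
  to_divisor p = to_divisor q <-> frac_le p q /\ frac_le q p.
Proof.
split=> [/(@eqquotP _ frac_eqv_equiv)/asboolP //|eqv_pq].
exact/(@eqquotP _ frac_eqv_equiv)/asboolP.
Qed.

Lemma to_divisorK p :
  frac_le (divisor_repr (to_divisor p)) p /\
  frac_le p (divisor_repr (to_divisor p)).
Proof. by apply/eq_to_divisor; rewrite divisor_reprK. Qed.

Definition divisor_le (X Y : Div) : bool :=
  `[< frac_le (divisor_repr X) (divisor_repr Y) >].

Lemma divisor_leE p q :
  divisor_le (to_divisor p) (to_divisor q) <-> frac_le p q.
Proof.
have [[le_pp' le_p'p] [le_qq' le_q'q]] := (to_divisorK p, to_divisorK q).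
split=> [/asboolP le_pq|le_pq].
  exact: frac_le_trans _ le_p'p (frac_le_trans _ le_pq le_qq').
by apply/asboolP; apply: frac_le_trans _ le_pp' (frac_le_trans _ le_pq le_q'q).
Qed.

Definition divisor_add (X Y : Div) : Div :=
  to_divisor (frac_mul (divisor_repr X) (divisor_repr Y)).

Lemma frac_le_mul2 p p' q q' :
  frac_le p p' -> frac_le q q' -> frac_le (frac_mul p q) (frac_mul p' q').
Proof.
move=> le_p le_q; apply: frac_le_trans _ (frac_le_mul _ le_p) _.
apply: frac_le_trans _ (frac_le_mulC _ _) _.
by apply: frac_le_trans _ (frac_le_mul _ le_q) (frac_le_mulC _ _).
Qed.

Lemma divisor_addE p q :
  divisor_add (to_divisor p) (to_divisor q) = to_divisor (frac_mul p q).
Proof.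
have [[le_pp' le_p'p] [le_qq' le_q'q]] := (to_divisorK p, to_divisorK q).
by apply/eq_to_divisor; split; apply: frac_le_mul2.
Qed.

Definition divisor_zero : Div := to_divisor (frac_div (regular_one A)).

Lemma divisor_addC : commutative divisor_add.
Proof.
move=> X Y; rewrite -[X]divisor_reprK -[Y]divisor_reprK !divisor_addE.
by apply/eq_to_divisor; split; apply: frac_le_mulC.
Qed.

Lemma divisor_addA : associative divisor_add.
Proof.
move=> X Y Z; rewrite -[X]divisor_reprK -[Y]divisor_reprK -[Z]divisor_reprK.
move: (divisor_repr X) (divisor_repr Y) (divisor_repr Z) => p q r.
rewrite !divisor_addE; apply/eq_to_divisor; split; first exact: frac_le_mulA.
(* The reverse inequality comes from the same associativity by commuting: (pq)r, r(qp), (rq)p,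
   p(qr). *)
apply: frac_le_trans _ (frac_le_mulC _ _) _.
apply: frac_le_trans _ (frac_le_mul2 (frac_le_refl _) (frac_le_mulC _ _)) _.
apply: frac_le_trans _ (frac_le_mulA _ _ _) _.
apply: frac_le_trans _ (frac_le_mulC _ _) _.
exact: frac_le_mul2 (frac_le_refl _) (frac_le_mulC _ _).
Qed.

Lemma divisor_add0 : left_id divisor_zero divisor_add.
Proof.
move=> X; rewrite -[X]divisor_reprK divisor_addE.
by apply/eq_to_divisor; split; [apply: frac_le_1mul|apply: frac_le_mul1].
Qed.

(** This is where divisorial invertibility enters the construction. *)
Lemma divisor_opp_subproof (X : Div) : exists Y, divisor_add Y X = divisor_zero.
Proof.
have [q eqv1] := frac_inverse (rwdA.2 _ (@num_neq0 _ (divisor_repr X))).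
exists (to_divisor q); rewrite divisor_addC -{1}[X]divisor_reprK divisor_addE.
exact/eq_to_divisor.
Qed.

Definition divisor_opp (X : Div) : Div := projT1 (cid (divisor_opp_subproof X)).

Lemma divisor_addN : left_inverse divisor_zero divisor_opp divisor_add.
Proof. by move=> X; apply: projT2 (cid (divisor_opp_subproof X)). Qed.

HB.instance Definition _ :=
  GRing.isZmodule.Build Div divisor_addA divisor_addC divisor_add0 divisor_addN.

Lemma divisor_le_refl : reflexive divisor_le.
Proof. by move=> X; apply/asboolP/frac_le_refl. Qed.

Lemma divisor_le_anti : antisymmetric divisor_le.
Proof.
move=> X Y /andP[/asboolP leXY /asboolP leYX].
by rewrite -[X]divisor_reprK -[Y]divisor_reprK; apply/eq_to_divisor.
Qed.

Lemma divisor_le_trans : transitive divisor_le.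
Proof.
by move=> Y X Z /asboolP leXY /asboolP /(frac_le_trans _ leXY) ?; apply/asboolP.
Qed.

HB.instance Definition _ := Order.isPOrder.Build ring_display Div
  (fun _ _ => erefl) divisor_le_refl divisor_le_anti divisor_le_trans.

Definition divisor_porderZmodType : porderZmodType := Div.

Lemma le_to_divisor p q : (to_divisor p <= to_divisor q) <-> frac_le p q.
Proof. exact: divisor_leE. Qed.

Lemma to_divisorD p q : to_divisor p + to_divisor q = to_divisor (frac_mul p q).
Proof. exact: divisor_addE. Qed.

End DivisorGroup.

(** * Infima and inequalities in lattice-ordered groups *)

Lemma is_infimum2P (G : porderZmodType) (m x y : G) :
  is_infimum m [:: x; y] <-> forall l, l <= m <-> l <= x /\ l <= y.
Proof.
split=> [[lb_m glb_m] l|inf_m]; split.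
- by move=> le_lm; split; apply: le_trans le_lm (lb_m _ _);
    rewrite !inE eqxx ?orbT.
- by move=> [le_lx le_ly]; apply: glb_m => h /[!inE]/orP[]/eqP->.
- have [le_mx le_my] := (inf_m m).1 (lexx m).
  by move=> h /[!inE]/orP[]/eqP->.
- by move=> l lb_l; apply/inf_m; split; apply: lb_l; rewrite !inE eqxx ?orbT.
Qed.

Section LatticeOrderedGroup.
Variables (G : porderZmodType) (hG : lattice_ordered_group G).
Implicit Types x y z : G.

Lemma lgroup_leD2l z x y : (z + x <= z + y) = (x <= y).
Proof.
apply/idP/idP=> [/(translation_le hG (- z))|]; first by rewrite !addKr.
exact: translation_le.
Qed.

Lemma lgroup_leD2r z x y : (x + z <= y + z) = (x <= y).
Proof. by rewrite ![_ + z]addrC lgroup_leD2l. Qed.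

Lemma lgroup_leD x y x' y' : x <= x' -> y <= y' -> x + y <= x' + y'.
Proof.
by move=> le_x le_y; rewrite (@le_trans _ _ (x + y')) ?lgroup_leD2l ?lgroup_leD2r.
Qed.

Lemma lgroup_leBr x y z : (x <= y - z) = (x + z <= y).
Proof. by rewrite -[LHS](lgroup_leD2r z) subrK. Qed.

Lemma lgroup_leBl x y z : (x - z <= y) = (x <= y + z).
Proof. by rewrite -[LHS](lgroup_leD2r z) subrK. Qed.

(** Describing the infimum by its lower bounds turns an inequality below it into one inequality per
    member, and conversely. *)
Lemma infimum_mapP (T : eqType) (f : T -> G) (s : seq T) (g : G) :
  is_infimum g (map f s) <->
  forall l, l <= g <-> (forall a, a \in s -> l <= f a).
Proof.
split=> [[lb_g glb_g] l|inf_g]; split.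
- by move=> le_lg a sa; apply: le_trans le_lg (lb_g _ (map_f f sa)).
- by move=> lb_l; apply: glb_g => _ /mapP[a sa ->]; apply: lb_l.
- by move=> _ /mapP[a sa ->]; apply: (inf_g g).1 sa; apply: lexx.
- by move=> l lb_l; apply/inf_g => a sa; apply/lb_l/map_f.
Qed.

Lemma exists_infimum (s : seq G) : s <> [::] -> exists g, is_infimum g s.
Proof.
elim: s => // x [|y s] IHs _.
  exists x; split=> [h /[!inE]/eqP-> //|l]; apply; exact: mem_head.
have [//|g [lb_g glb_g]] := IHs.
have [m /is_infimum2P inf_m] := infimum2 hG x g; exists m; split=> [h|l lb_l].
  have [le_mx le_mg] := (inf_m m).1 (lexx m).
  by rewrite inE => /predU1P[-> //|/lb_g]; apply: le_trans.
apply/inf_m; split; first by apply: lb_l; rewrite mem_head.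
by apply: glb_g => k sk; apply: lb_l; rewrite inE sk orbT.
Qed.

End LatticeOrderedGroup.

(* In an ordered group, the supremum of x and y is x + y minus their infimum. *)
Lemma lattice_ordered_group_infimum (G : porderZmodType) :
  (forall z x y : G, x <= y -> z + x <= z + y) ->
  (forall x y : G, exists m, is_infimum m [:: x; y]) ->
  lattice_ordered_group G.
Proof.
move=> leD inf2; split=> // x y; have [m /is_infimum2P inf_m] := inf2 x y.
have [le_mx le_my] := (inf_m m).1 (lexx m).
exists (x + y - m); split=> [h /[!inE]/orP[]/eqP->|u ub_u].
- by have := leD (x - m) _ _ le_my; rewrite subrK addrAC.
- by have := leD (y - m) _ _ le_mx; rewrite subrK addrAC [y + x]addrC.
have [le_xu le_yu] : x <= u /\ y <= u.
  by split; apply: ub_u; rewrite !inE eqxx ?orbT.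
have /(leD (u - m)) : x + y - u <= m.
  apply/inf_m; split.
    by have := leD (x - u) _ _ le_yu; rewrite subrK addrAC.
  by have := leD (y - u) _ _ le_xu; rewrite subrK addrAC [y + x]addrC.
by rewrite subrK addrC addrA subrK.
Qed.

(** * Consequences of a divisor theory: invertibility, and representation by fractions *)

Section DivisorTheory.
Variables (A : comPzRingType) (G : porderZmodType) (div : regular A -> G).
Hypothesis divG : is_divisor_theory div.
Implicit Types (a b : regular A) (s t : seq (regular A)) (p q : fraction A).

Let hG := div_lgroup divG.

(** Since [a] is in [s], the difference [div a - g] is nonnegative and (D3) applies; [t] is an
    inverse of [s] up to the factor [a]. *)
Lemma divisor_cofactor s g a :
    (forall l, l <= g <-> (forall a, a \in s -> l <= div a)) -> a \in s ->
  exists t, t <> [::] /\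
    forall l : G, l <= div a - g <-> (forall b, b \in t -> l <= div b).
Proof.
move=> inf_g sa; have ge0 : 0 <= div a - g.
  by rewrite lgroup_leBr // add0r; apply: (inf_g g).1 sa.
by have [t [t_neq0 /infimum_mapP]] := div_inf divG ge0; exists t.
Qed.

Lemma divisor_theory_ring_with_divisors :
  integral_ring A -> ring_with_divisors A.
Proof.
move=> hA; split=> // s s_neq0.
have [g /infimum_mapP inf_g] := exists_infimum hG (map_neq0 (f := div) s_neq0).
case: s s_neq0 inf_g => // a s' _; set s := a :: s' => inf_g.
have sa : a \in s by apply: mem_head.
have [t [t_neq0 inf_t]] := divisor_cofactor inf_g sa.
(* The infimum of the [div] of the products is [g + (div a - g) = div a], so [a] is their gcd. *)
exists t, a; apply/strong_gcdP; split.
  move=> _ /list_mulP[b [c [sb tc ->]]]; apply/(div_le divG).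
  rewrite (div_mul divG) addrC -(subrK g (div a)) lgroup_leD //.
    exact: (inf_t _).1 tc.
  exact: (inf_g _).1 sb.
move=> x y dvd_y.
have reg_y : GRing.lreg y.
  case: t t_neq0 inf_t dvd_y => // b t _ _ dvd_y.
  apply: (@divides_regular _ (regular_mul x (regular_mul a b))).
  exact: (dvd_y _ (mem_list_mul sa (mem_head b t))).
(* Writing [div a] as [(div a - g) + g], the bound is checked by taking the infimum over [s] and
   then the infimum over [t]. *)
have := div_le divG (Regular y reg_y) (regular_mul x a) => /= <-.
rewrite (div_mul divG) -[div a](subrK g) addrA addrC -lgroup_leBl //.
apply/inf_g => b sb.
rewrite lgroup_leBl // addrA [_ + (div a - g)]addrC -lgroup_leBl //.
apply/inf_t => c tc; rewrite lgroup_leBl // -!(div_mul divG) div_le //.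
apply: divides_eq (dvd_y _ (mem_list_mul sb tc)) _.
by rewrite /=; ring.
Qed.

(** This says that [g] is inf div(num p) - div (den p), with the infimum expressed through its lower
    bounds. *)
Definition represents (g : G) p : Prop :=
  forall l : G, l <= g + div (den p) <->
    (forall a, a \in num p -> l <= div a).

(** With [m] the infimum of [g] and 0, (D3) gives a [c] such that [div c] is at least [- m]. Then
    [g + div c] is nonnegative, and (D3) again supplies the numerators. *)
Lemma represents_exists g : exists p, represents g p.
Proof.
have [m /is_infimum2P inf_m] := infimum2 hG g 0.
have [le_mg le_m0] := (inf_m m).1 (lexx m).
have m_ge0 : 0 <= - m.
  by rewrite -[- m]add0r lgroup_leBr // add0r.
have [[|c u] [u_neq0 [lb_c _]]] := div_inf divG m_ge0; first by case: u_neq0.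
have ge0 : 0 <= g + div c.
  rewrite -(addNr m) addrC lgroup_leD //.
  by rewrite lb_c // mem_head.
have [s [s_neq0 /infimum_mapP inf_s]] := div_inf divG ge0.
by exists (Fraction c s_neq0).
Qed.

Lemma exists_represented p : exists g, represents g p.
Proof.
have [h /infimum_mapP inf_h] :=
  exists_infimum hG (map_neq0 (f := div) (@num_neq0 _ p)).
by exists (h - div (den p)) => l; rewrite subrK.
Qed.

(** The order of the group is read off from divisibility in A alone. The converse direction works
    because an infimum of values of [div] is also a supremum of differences [div y - div x], and
    these are what [frac_le] tests. *)
Lemma represents_le g g' p p' :
  represents g p -> represents g' p' -> (g <= g' <-> frac_le p p').
Proof.
move=> rep_p rep_p'; split=> [le_gg' b p'b x y dvd_y|le_pp'].
  have [a pa] : exists a, a \in num p.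
    by case: (num p) (@num_neq0 _ p) => // a s _; exists a; apply: mem_head.
  have reg_y : GRing.lreg y.
    apply: (@divides_regular _ (regular_mul (regular_mul x (den p')) a)).
    exact: dvd_y.
  apply/(div_le divG (Regular y reg_y)
           (regular_mul (regular_mul x (den p)) b)).
  rewrite !(div_mul divG).
  (* The divisibility hypotheses bound this difference by [g + div (den p)]; [g <= g'] then carries
     the bound over to [p']. *)
  have : div (Regular y reg_y) - (div x + div (den p')) <= g' + div (den p).
    apply: (@le_trans _ _ (g + div (den p))); last by rewrite lgroup_leD2r.
    apply/rep_p => c pc; rewrite lgroup_leBl // addrC -!(div_mul divG).
    by apply/(div_le divG)/dvd_y.
  rewrite lgroup_leBl // => /le_trans; apply.
  rewrite [div x + div (den p')]addrC addrACA addrC [in leRHS]addrC.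
  rewrite [div (den p) + _]addrC [leRHS]addrC lgroup_leD2l //.
  by apply: (rep_p' _).1 p'b; apply: lexx.
have [h inf_h h_eq] : exists2 h : G,
    (forall l : G, l <= h <-> (forall a, a \in num p -> l <= div a)) &
    h = g + div (den p) by exists (g + div (den p)).
have [a pa] : exists a, a \in num p.
  by case: (num p) (@num_neq0 _ p) => // a s _; exists a; apply: mem_head.
(* As [div a - h] is the infimum of the [div v] for [v] in [u], [h] is the supremum of the
   [div a - div v]. So it suffices to test [frac_le] at [x = v] and [y = a * den p']. *)
have [u [_ inf_u]] := divisor_cofactor inf_h pa.
rewrite -(lgroup_leD2r hG (div (den p'))); apply/rep_p' => b p'b.
have : div a + div (den p') - (div (den p) + div b) <= div a - h.
  apply/inf_u => v uv; rewrite lgroup_leBl // -!(div_mul divG).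
  apply/(div_le divG).
  apply: divides_eq (le_pp' _ p'b v (regular_mul a (den p')) _) _; last first.
    by rewrite /=; ring.
  move=> c pc.
  suff: divides (a : A) ((v : A) * (c : A)).
    move/(divides_mul2 (den p')) => dvd; apply: divides_eq.
      by rewrite /= mulrC; apply: dvd.
    by rewrite /=; ring.
  apply/(div_le divG a (regular_mul v c)); rewrite (div_mul divG).
  rewrite -[div a](subrK h) lgroup_leD //.
    exact: (inf_u _).1 uv.
  exact: (inf_h _).1 pc.
rewrite h_eq lgroup_leBl // -!addrA lgroup_leD2l // opprD -addrA addKr.
by rewrite addrC lgroup_leBr // addrC.
Qed.

(** Translations preserve infima, so the infimum over products is taken one factor at a time. *)
Lemma represents_mul g g' p p' : represents g p -> represents g' p' ->
  represents (g + g') (frac_mul p p').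
Proof.
move=> rep_p rep_p' l; rewrite /= (div_mul divG) addrACA; split=> [le_l|lb_l].
  move=> _ /list_mulP[a [b [pa p'b ->]]]; apply: le_trans le_l _.
  rewrite (div_mul divG) lgroup_leD //; first exact: (rep_p _).1 pa.
  exact: (rep_p' _).1 p'b.
rewrite -lgroup_leBl //; apply/rep_p => a pa.
rewrite lgroup_leBl // [leRHS]addrC -lgroup_leBl //; apply/rep_p' => b p'b.
rewrite lgroup_leBl // addrC -(div_mul divG).
exact/lb_l/mem_list_mul.
Qed.

Lemma represents_div a : represents (div a) (frac_div a).
Proof.
move=> l; rewrite /= (div_one divG) addr0; split=> [le_l _ /[!inE]/eqP-> //|].
by apply; apply: mem_head.
Qed.

End DivisorTheory.

(** * Comparison of two divisor theories *)

Section DivisorIsomorphism.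
Variables (A : comPzRingType) (G H : porderZmodType).
Variables (divG : regular A -> G) (divH : regular A -> H).
Hypotheses (thG : is_divisor_theory divG) (thH : is_divisor_theory divH).

(** The graph of the isomorphism. As a relation it is symmetric in the two groups, so the inverse
    map needs no separate treatment. *)
Definition same_divisor (g : G) (h : H) : Prop :=
  exists p, represents divG g p /\ represents divH h p.

Lemma same_divisor_total g : exists h, same_divisor g h.
Proof.
have [p rep_p] := represents_exists thG g.
by have [h rep_h] := exists_represented thH p; exists h, p.
Qed.

Lemma same_divisor_le g g' h h' :
  same_divisor g h -> same_divisor g' h' -> (h <= h') = (g <= g').
Proof.
move=> [p [gp hp]] [p' [gp' hp']]; apply/idP/idP.
  by move/(represents_le thH hp hp')/(represents_le thG gp gp').
by move/(represents_le thG gp gp')/(represents_le thH hp hp').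
Qed.

Lemma same_divisorD g g' h h' :
  same_divisor g h -> same_divisor g' h' -> same_divisor (g + g') (h + h').
Proof.
move=> [p [gp hp]] [p' [gp' hp']].
by exists (frac_mul p p'); split; apply: represents_mul.
Qed.

Lemma same_divisor_div a : same_divisor (divG a) (divH a).
Proof. by exists (frac_div a); split; apply: represents_div. Qed.

Lemma same_divisor_funct g h h' :
  same_divisor g h -> same_divisor g h' -> h = h'.
Proof.
move=> gh gh'; apply: le_anti.
by rewrite (same_divisor_le gh gh') (same_divisor_le gh' gh) lexx.
Qed.

(** An isomorphism compatible with the two [div] maps carries infima of their values to infima, so
    it preserves the representing fraction. Its graph therefore lies in [same_divisor], which yields
    uniqueness. *)
Lemma isomorphism_same_divisor (psi : G -> H) :
  lgroup_isomorphism psi -> (forall a, psi (divG a) = divH a) ->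
  forall g, same_divisor g (psi g).
Proof.
move=> [[psi' psiK psi'K] psiD le_psi] psi_div g.
have [p rep_p] := represents_exists thG g; exists p; split=> // l.
rewrite -[l]psi'K -psi_div -psiD le_psi; split=> [/rep_p lb_l a pa|lb_l].
  by rewrite -psi_div le_psi lb_l.
by apply/rep_p => a pa; rewrite -le_psi psi_div lb_l.
Qed.

End DivisorIsomorphism.

(** The relation is total in both directions, so choice gives two maps; functionality makes them
    mutually inverse. *)
Lemma divisor_isomorphism (A : comPzRingType) (G H : porderZmodType)
    (divG : regular A -> G) (divH : regular A -> H) :
    is_divisor_theory divG -> is_divisor_theory divH ->
  exists phi : G -> H,
    lgroup_isomorphism phi /\ forall g, same_divisor divG divH g (phi g).
Proof.
move=> thG thH.
have [phi phiP] := choice (same_divisor_total thG thH).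
have [phi' phi'P] := choice (same_divisor_total thH thG).
have same_sym (K L : porderZmodType) (d : regular A -> K) (e : regular A -> L)
    g h : same_divisor d e g h -> same_divisor e d h g.
  by case=> p []; exists p.
exists phi; split=> //; split.
- exists phi' => x.
    exact/(same_divisor_funct thH thG (phi'P _))/same_sym.
  exact/(same_divisor_funct thG thH (phiP _))/same_sym.
- move=> x y; apply: (same_divisor_funct thG thH (phiP _)).
  exact: same_divisorD.
- by move=> x y; apply: (same_divisor_le thG thH).
Qed.

(** * Existence of a divisor theory over a ring with divisors, and the conclusion *)

Lemma divisor_theory_exists (A : comPzRingType) (rwdA : ring_with_divisors A) :
  is_divisor_theory (G := divisor_porderZmodType rwdA)
    (fun a => to_divisor rwdA (frac_div a)).
Proof.
split.
- apply: lattice_ordered_group_infimum.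
    move=> Z X Y; rewrite -[X]divisor_reprK -[Y]divisor_reprK -[Z]divisor_reprK.
    move=> /le_to_divisor le_XY; rewrite ![to_divisor _ (divisor_repr Z) + _]addrC.
    by rewrite !to_divisorD; apply/le_to_divisor/frac_le_mul.
  move=> X Y; rewrite -[X]divisor_reprK -[Y]divisor_reprK.
  move: (divisor_repr X) (divisor_repr Y) => p q.
  exists (to_divisor rwdA (frac_inf p q)); apply/is_infimum2P => l.
  rewrite -[l]divisor_reprK; split=> [/le_to_divisor le_l|].
    split; apply/le_to_divisor; apply: frac_le_trans _ le_l _.
      exact: frac_le_infl.
    exact: frac_le_infr.
  by case=> /le_to_divisor le_lp /le_to_divisor le_lq;
    apply/le_to_divisor/frac_le_inf.
- move=> a; apply/le_to_divisor/frac_le_div; exists (a : A).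
  by rewrite mulr1.
- by [].
- move=> a b; rewrite to_divisorD; apply/eq_to_divisor; split.
    exact: frac_le_divM.
  exact: frac_le_Mdiv.
- by move=> a b; apply: iff_trans (le_to_divisor rwdA _ _) (frac_le_div a b).
- move=> X; rewrite -[X]divisor_reprK => /le_to_divisor/frac_ge0_inf.
  move=> [s [s_neq0 lb_s glb_s]]; exists s; split=> //; split.
    by move=> _ /mapP[a sa ->]; apply/le_to_divisor/lb_s.
  move=> l lb_l; rewrite -[l]divisor_reprK; apply/le_to_divisor/glb_s => b sb.
  (* The lower bound [l] was replaced by a representative to apply the statement on fractions; here
     it returns to the quotient. *)
  apply/(le_to_divisor rwdA); rewrite divisor_reprK; apply: lb_l.
  exact: (map_f (fun a => to_divisor rwdA (frac_div a))).
Qed.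

Theorem mainTheorem1 (A : comPzRingType) (hA : integral_ring A) :
  ((exists (G : porderZmodType) (div : regular A -> G), is_divisor_theory div)
     <-> ring_with_divisors A)
  /\
  (ring_with_divisors A ->
   forall (G H : porderZmodType)
          (divG : regular A -> G) (divH : regular A -> H),
     is_divisor_theory divG -> is_divisor_theory divH ->
     exists phi : G -> H,
       (lgroup_isomorphism phi /\ forall a, phi (divG a) = divH a) /\
       forall psi : G -> H,
         lgroup_isomorphism psi -> (forall a, psi (divG a) = divH a) ->
         psi =1 phi).
Proof.
split; first split=> [[G [div divP]]|rwdA].
- exact: divisor_theory_ring_with_divisors divP hA.
- by exists (divisor_porderZmodType rwdA); eexists; apply: divisor_theory_exists.
move=> _ G H divG divH thG thH.
have [phi [iso_phi same_phi]] := divisor_isomorphism thG thH.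
exists phi; split; first split=> // a.
  exact: (same_divisor_funct thG thH (same_phi _) (same_divisor_div thG thH a)).
(* Both [psi g] and [phi g] are related to [g] by [same_divisor], which is functional. *)
move=> psi iso_psi psi_div g.
apply: (same_divisor_funct thG thH _ (same_phi g)).
exact: isomorphism_same_divisor.
Qed.
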